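(* Let $u^{(1)},\dots,u^{(n)}\in\mathbb{Z}^d$ and let $\Gamma=\{L_{u^{(1)}},\dots,L_{u^{(n)}}\}$. Then the Plesken–Zassenhaus order $$\mathrm{PZ}(\Gamma)=\mathrm{End}_{\mathcal{O}_K}(L_{u^{(1)}})\cap\cdots\cap\mathrm{End}_{\mathcal{O}_K}(L_{u^{(n)}})$$ coincides with the lattice $\Lambda_M=\{X\in K^{d\times d}:\mathrm{val}(x_{ij})\ge m_{ij}\ \forall i,j\}$, where $$M=M(u^{(1)})\,\overline{\oplus}\,M(u^{(2)})\,\overline{\oplus}\,\cdots\,\overline{\oplus}\,M(u^{(n)}),$$ i.e.\ $m_{ij}=\max_{1\le k\le n}\big(u^{(k)}_i-u^{(k)}_j\big)$. Moreover, this matrix $M$ is min-plus idempotent: $m_{ij}+m_{jk}\ge m_{ik}$ for all $1\le i,j,k\le d$, and $M\,\underline{\odot}\,M=M$.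
   Context: $K$ is a field with a surjective discrete valuation $\mathrm{val}:K\to\mathbb{Z}\cup\{\infty\}$, $p\in K$ with $\mathrm{val}(p)=1$, $\mathcal{O}_K$ its valuation ring. For $u\in\mathbb{Z}^d$, $L_u=\mathrm{diag}(p^{u_1},\dots,p^{u_d})\,\mathcal{O}_K^d$ and $M(u)$ is the $d\times d$ matrix with $(i,j)$ entry $u_i-u_j$. For a lattice $L\subset K^d$, $\mathrm{End}_{\mathcal{O}_K}(L)=\{X\in K^{d\times d}:XL\subseteq L\}$. $\overline{\oplus}$ denotes entrywise maximum of matrices, and $\underline{\odot}$ the min-plus matrix product $(A\,\underline{\odot}\,B)_{ik}=\min_j(a_{ij}+b_{jk})$. *)

(* Defs.v *)
From HB Require Import structures.
From mathcomp Require Import all_boot all_order all_algebra.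
From mathcomp Require Import classical_sets constructive_ereal.

Set Implicit Arguments.
Unset Strict Implicit.
Unset Printing Implicit Defensive.

Import Order.TTheory GRing.Theory Num.Theory.
Local Open Scope classical_set_scope.
Local Open Scope ring_scope.

(* The target Z u {oo} is rendered as [\bar int] with the extra element -oo
   excluded by [dval_neqNy]. *)
Record surjective_discrete_valuation (K : fieldType) (v : K -> \bar int) :
    Prop := SurjectiveDiscreteValuation {
  dval_neqNy : forall x, v x <> -oo%E;
  dval_eqy : forall x, v x = +oo%E <-> x = 0;
  dvalM : forall x y, v (x * y) = (v x + v y)%E;
  dvalD : forall x y, (Order.min (v x) (v y) <= v (x + y)%R)%E;
  dval_surj : forall m : int, exists x, v x = m%:E
}.

Definition valuation_ring (K : fieldType) (v : K -> \bar int) : set K :=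
  [set x | (0 <= v x)%E].

Definition std_lattice (K : fieldType) (v : K -> \bar int) (d : nat) :
    set 'cV[K]_d :=
  [set y : 'cV[K]_d | forall i, valuation_ring v (y i 0)].

Definition diag_lattice (K : fieldType) (v : K -> \bar int) (p : K) (d : nat)
    (u : 'rV[int]_d) : set 'cV[K]_d :=
  mulmx (diag_mx (\row_i p ^ u 0 i)) @` @std_lattice K v d.

Definition End_lattice (K : fieldType) (d : nat) (L : set 'cV[K]_d) :
    set 'M[K]_d :=
  [set X : 'M[K]_d | mulmx X @` L `<=` L].

Definition PZ (K : fieldType) (d : nat) (Gamma : set (set 'cV[K]_d)) :
    set 'M[K]_d :=
  \bigcap_(L in Gamma) End_lattice L.

Definition Lambda (K : fieldType) (v : K -> \bar int) (d : nat)
    (M : 'M[int]_d) : set 'M[K]_d :=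
  [set X : 'M[K]_d | forall i j, ((M i j)%:E <= v (X i j))%E].

Definition diff_mx (d : nat) (u : 'rV[int]_d) : 'M[int]_d :=
  \matrix_(i, j) (u 0 i - u 0 j).

Definition max_mx (d : nat) (A B : 'M[int]_d) : 'M[int]_d :=
  \matrix_(i, j) Num.max (A i j) (B i j).

(* The minimum over all j; since int has no top element, the iteration starts
   from the term j = i, which is one of those being minimized. *)
Definition minplus_mulmx (d : nat) (A B : 'M[int]_d) : 'M[int]_d :=
  \matrix_(i, k) \big[Num.min/(A i i + B i k)]_(j < d) (A i j + B j k).

(* Nonempty families only: the iteration starts from the first matrix and
   ranges over the others. *)
Definition max_diff_mx (d n : nat) (u : 'I_n.+1 -> 'rV[int]_d) : 'M[int]_d :=
  \big[@max_mx d/diff_mx (u ord0)]_(k < n) diff_mx (u (lift ord0 k)).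

(* Main.v *)
(* Membership in L_u means val(y_i) >= u_i for all i. Testing an endomorphism of
   L_u on the vectors p^(u_j) e_j therefore yields val(x_ij) >= u_i - u_j, and
   conversely the ultrametric inequality makes these bounds sufficient.
   Intersecting over k replaces the bounds by their maximum. The telescoping
   u_i - u_k = (u_i - u_j) + (u_j - u_k) survives the maximum as the inequality
   m_ik <= m_ij + m_jk, and m_ii = 0 shows that the minimum defining the
   min-plus square is attained at j = i. *)
Require Import Defs.
From HB Require Import structures.
From mathcomp Require Import all_boot all_order all_algebra.
From mathcomp Require Import classical_sets constructive_ereal.

Set Implicit Arguments.
Unset Strict Implicit.
Unset Printing Implicit Defensive.

Import Order.TTheory GRing.Theory Num.Theory.
Local Open Scope classical_set_scope.
Local Open Scope ring_scope.

Section Valuation.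

Variables (K : fieldType) (v : K -> \bar int).
Hypothesis hv : surjective_discrete_valuation v.

Lemma dval0 : v 0 = +oo%E.
Proof. exact/(dval_eqy hv). Qed.

(** From [1 * 1 = 1], the value [v 1] equals its own double, so it is 0 once finite; [1 != 0]
    excludes [+oo]. *)
Lemma dval1 : v 1 = 0%:E.
Proof.
have := dvalM hv 1 1; rewrite mulr1.
case E : (v 1) => [m||] //=.
- by move=> [] /eqP; rewrite -subr_eq subrr => /eqP <-.
- by move/(dval_eqy hv)/eqP: E; rewrite oner_eq0.
- by have := dval_neqNy hv E.
Qed.

Lemma dval_sum_ge (I : Type) (r : seq I) (F : I -> K) (m : \bar int) :
  (forall i, m <= v (F i))%E -> (m <= v (\sum_(i <- r) F i)%R)%E.
Proof.
move=> hF; elim/big_ind: _ => [|x y hx hy|i _]; last exact: hF.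
- by rewrite dval0 leey.
- by apply: le_trans (dvalD hv x y); rewrite le_min hx.
Qed.

Variable p : K.
Hypothesis hp : v p = 1%:E.

Lemma uniformizer_neq0 : p != 0.
Proof. by apply/eqP => /(dval_eqy hv); rewrite hp. Qed.

Lemma dval_expz (m : int) : v (p ^ m) = m%:E.
Proof.
have vX (n : nat) : v (p ^+ n) = n%:Z%:E.
  elim: n => [|n IHn]; first exact: dval1.
  by rewrite exprS (dvalM hv) hp IHn intS.
case: m => n; first exact: vX.
have pn0 : p ^+ n.+1 != 0 by rewrite expf_neq0 // uniformizer_neq0.
(* Negative exponents: the values of [p ^- n.+1] and [p ^+ n.+1] add up to 0, which forces the first
   to be finite and determines it. *)
have := dvalM hv (p ^- n.+1) (p ^+ n.+1).
rewrite mulVf // dval1 vX /exprz.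
case: (v _) => [k||] //= [] /esym/eqP.
by rewrite addr_eq0 => /eqP ->; rewrite NegzE.
Qed.

Lemma diag_latticeE (d : nat) (u : 'rV[int]_d) (y : 'cV[K]_d) :
  diag_lattice v p u y <-> forall i, ((u 0%R i)%:E <= v (y i 0%R))%E.
Proof.
have pu0 i : p ^ u 0 i != 0 by rewrite expfz_neq0 // uniformizer_neq0.
split.
- case=> z hz <- i; rewrite mul_diag_mx !mxE (dvalM hv) dval_expz.
  exact/leeDl/hz.
- move=> hy; exists (\col_i (p ^ (- u 0 i) * y i 0)).
  + move=> i; rewrite /valuation_ring /= mxE (dvalM hv) dval_expz.
    by rewrite addeC EFinN sube_ge0.
  + apply/matrixP => i j; rewrite (ord1 j) mul_diag_mx !mxE mulrA.
    by rewrite -expfzDr ?uniformizer_neq0 // subrr mul1r.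
Qed.

Lemma End_diag_latticeE (d : nat) (u : 'rV[int]_d) :
  End_lattice (diag_lattice v p u) = Lambda v (diff_mx u).
Proof.
apply/seteqP; split=> X /= hX.
- move=> i j; rewrite mxE.
  have /diag_latticeE/(_ i) :
      diag_lattice v p u (X *m (p ^ u 0 j *: delta_mx j 0)).
    apply: hX; exists (p ^ u 0 j *: delta_mx j 0) => //.
    apply/diag_latticeE => l; rewrite !mxE andbT.
    (* Coordinate [j] has value exactly [u 0 j]; the others vanish and have value [+oo]. *)
    by case: eqP => [->|_]; rewrite ?mulr1 ?mulr0 ?dval_expz ?dval0 ?leey.
  rewrite -scalemxAr -colE !mxE (dvalM hv) dval_expz.
  by rewrite EFinB leeBlDl.
- move=> _ [y /diag_latticeE hy <-]; apply/diag_latticeE => i.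
  rewrite mxE; apply: dval_sum_ge => j; rewrite (dvalM hv).
  (* Splitting u_i as (u_i - u_j) + u_j matches the bound on x_ij with the bound on y_j. *)
  rewrite -[u 0 i](subrK (u 0 j)) EFinD; apply: leeD (hy j).
  by have := hX i j; rewrite mxE.
Qed.

End Valuation.

Section MaxDiff.

Variables (d n : nat) (u : 'I_n.+1 -> 'rV[int]_d).
Implicit Types i j k : 'I_d.

Lemma max_diff_mxE i j :
  max_diff_mx u i j =
    \big[Num.max/(u ord0 0 i - u ord0 0 j)]_(l < n.+1) (u l 0 i - u l 0 j).
Proof.
(* The term at [ord0] repeats the start value of the maximum, so it is absorbed. *)
rewrite big_ord_recl max_r ?bigmax_ge_id // /max_diff_mx.
(* Reading off the entry (i, j) turns [max_mx] into [Num.max] and the start matrix into the start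
   value. *)
rewrite (big_morph (fun A : 'M_d => A i j)
           (id1 := u ord0 0 i - u ord0 0 j) (op1 := Num.max)).
- by apply: eq_bigr => l _; rewrite mxE.
- by move=> A B; rewrite mxE.
- by rewrite mxE.
Qed.

Lemma max_diff_mx_ge l i j : u l 0 i - u l 0 j <= max_diff_mx u i j.
Proof. by rewrite max_diff_mxE; exact: le_bigmax. Qed.

Lemma max_diff_mx_le i j (m : int) :
  (forall l, u l 0 i - u l 0 j <= m) -> max_diff_mx u i j <= m.
Proof. by move=> h; rewrite max_diff_mxE; apply: bigmax_le. Qed.

Lemma max_diff_mx_diag i : max_diff_mx u i i = 0.
Proof.
apply/le_anti/andP; split.
- by apply: max_diff_mx_le => l; rewrite subrr.
- by rewrite -(subrr (u ord0 0 i)) max_diff_mx_ge.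
Qed.

Lemma max_diff_mx_triangle i j k :
  max_diff_mx u i k <= max_diff_mx u i j + max_diff_mx u j k.
Proof.
apply: max_diff_mx_le => l.
by rewrite -(subrKA (u l 0 j)) lerD ?max_diff_mx_ge.
Qed.

Lemma minplus_max_diff_mx :
  minplus_mulmx (max_diff_mx u) (max_diff_mx u) = max_diff_mx u.
Proof.
(* The start value m_ii + m_ik of the minimum becomes m_ik, an upper bound; the triangle inequality
   makes it a lower bound as well. *)
apply/matrixP => i k; rewrite mxE max_diff_mx_diag add0r.
apply/le_anti/andP; split; first exact: bigmin_le_id.
by apply: le_bigmin => // j _; exact: max_diff_mx_triangle.
Qed.

Lemma Lambda_max_diff_mx (K : fieldType) (v : K -> \bar int) :
  Lambda v (max_diff_mx u) = \bigcap_l Lambda v (diff_mx (u l)).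
Proof.
apply/seteqP; split=> X /= hX.
- move=> l _ i j; apply: le_trans (hX i j).
  by rewrite lee_fin mxE max_diff_mx_ge.
- move=> i j; have := fun l => hX l I i j.
  (* The value [-oo] violates the bound at [ord0], which exists because the family is nonempty. *)
  case: (v _) => [m||] h; last by have := h ord0.
  + rewrite lee_fin; apply: max_diff_mx_le => l.
    by have := h l; rewrite lee_fin mxE.
  + exact: leey.
Qed.

End MaxDiff.

Theorem theorem3p3 (K : fieldType) (v : K -> \bar int)
    (hv : surjective_discrete_valuation v) (p : K) (hp : v p = 1%:E)
    (d n : nat) (u : 'I_n.+1 -> 'rV[int]_d) :
  let Gamma := [set diag_lattice v p (u k) | k in [set: 'I_n.+1]] in
  let M := max_diff_mx u in
  [/\ PZ Gamma = \bigcap_(k in [set: 'I_n.+1])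
                      End_lattice (diag_lattice v p (u k)),
      PZ Gamma = Lambda v M,
      forall i j, M i j =
        \big[Num.max/(u ord0 0 i - u ord0 0 j)]_(k < n.+1) (u k 0 i - u k 0 j),
      forall i j k, M i k <= M i j + M j k
    & minplus_mulmx M M = M].
Proof.
move=> Gamma M.
have PZE : PZ Gamma =
    \bigcap_(k in [set: 'I_n.+1]) End_lattice (diag_lattice v p (u k)).
  by rewrite /PZ bigcap_image.
split=> //.
- rewrite PZE Lambda_max_diff_mx.
  by apply: eq_bigcapr => k _; exact: End_diag_latticeE.
- exact: max_diff_mxE.
- exact: max_diff_mx_triangle.
- exact: minplus_max_diff_mx.
Qed.
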